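(* Let $G=(V,E)$ be a cycle on $2n+1$ vertices with $n\ge 1$. Then the acyclic orientations of $E$ whose induced posets have the maximum number of linear extensions (among all acyclic orientations of $E$) are exactly the almost bipartite orientations.
   Context: An acyclic orientation of $E$ induces a partial order on $V$ in which $u<v$ if and only if there is a directed path from $u$ to $v$. A linear extension of a partial order $P$ on an $m$-element set $V$ is a bijection $\sigma:V\to[m]$ such that $u<_P v$ implies $\sigma(u)<\sigma(v)$. An acyclic orientation of an odd cycle is called almost bipartite if it contains exactly one directed $2$-path, i.e. exactly one instance of directed edges $(u,v)$ and $(v,w)$ with $u,v,w\in V$. *)

(* Defs.v *)
From mathcomp Require Import all_boot all_fingroup.
Set Implicit Arguments. Unset Strict Implicit. Unset Printing Implicit Defensive.

(* The cycle C_m on vertex set 'I_m with edges {i, i+1 mod m} (m >= 3).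
   An orientation of the edge set is encoded by o : 'I_m -> bool, where
   o i = true  means the edge {i, i+1} is directed i -> i+1, and
   o i = false means it is directed i+1 -> i. *)
Definition cycle_orientation (m : nat) := 'I_m -> bool.

Definition arc (m : nat) (o : cycle_orientation m) : rel 'I_m :=
  fun u v => (o u && (v == ordS u)) || (~~ o v && (u == ordS v)).

(* u < v in the induced poset: a directed path (of length >= 1) from u to v *)
Definition dlt (m : nat) (o : cycle_orientation m) (u v : 'I_m) : bool :=
  [exists w, arc o u w && connect (arc o) w v].

Definition acyclic (m : nat) (o : cycle_orientation m) : bool :=
  [forall u, ~~ dlt o u u].

Definition linear_extensions (m : nat) (o : cycle_orientation m) :=
  [set s : {perm 'I_m} | [forall u, forall v, dlt o u v ==> (s u < s v)]].

Definition num_linext (m : nat) (o : cycle_orientation m) : nat :=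
  #|linear_extensions o|.

Definition num_dir_2paths (m : nat) (o : cycle_orientation m) : nat :=
  #|[set t : 'I_m * 'I_m * 'I_m | arc o t.1.1 t.1.2 && arc o t.1.2 t.2]|.

Definition almost_bipartite (m : nat) (o : cycle_orientation m) : Prop :=
  acyclic o /\ num_dir_2paths o = 1.

(* Main.v *)
Require Import Defs.
From mathcomp Require Import all_boot all_fingroup zify.
Set Implicit Arguments. Unset Strict Implicit. Unset Printing Implicit Defensive.

(** The linear extensions of an orientation are the permutations s of the cycle
    with s i < s (i + 1) exactly along the edges directed forwards.  If the
    orientation has two directed 2-paths, with middle vertices v and w, cut the
    cycle at v and w into two arcs and reverse all arrows of one arc.  Both
    indicator functions "the first (second) arc is respected" are monotone in the
    labels of v and of w, in opposite directions before the reversal and in the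
    same direction after it.  Hence by Chebyshev's inequality, applied at v and
    then at w, the probability that a random labelling respects both arcs is
    below the product of the two probabilities before the reversal and above it
    afterwards, while the product itself is unchanged by the symmetry
    x -> 1 - x.  So the reversal increases the number of linear extensions and
    removes two directed 2-paths.  On an odd cycle the number of directed 2-paths
    is odd, and all orientations with exactly one of them are equivalent under
    rotations and global reversal.

    To stay with permutations, independent labels for v and w are obtained from
    two additional positions: an arc may use v' and w' instead of v and w. *)

(** * Permutations from ranks, and order reversal on a set of positions *)

Lemma perm_of_injective_ranks N (h : 'I_N -> nat) : injective h ->
  exists t : {perm 'I_N}, forall a b, (t a < t b) = (h a < h b).
Proof.
move=> h_inj; pose S a := [set z | h z < h a].
have S_lt a b : h a < h b -> #|S a| < #|S b|.
  move=> ab; apply/proper_card/properP; split.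
    by apply/subsetP=> z; rewrite !inE => /ltn_trans; apply.
  by exists a; rewrite inE ?ltnn.
have S_bound a : #|S a| < N.
  rewrite -[X in _ < X]card_ord -cardsT; apply/proper_card/properP; split=> //.
  by exists a; rewrite inE ?ltnn.
have S_inj : injective (fun a => Ordinal (S_bound a)).
  move=> a b [] Sab; apply: h_inj.
  by case: (ltngtP (h a) (h b)) => // /S_lt; rewrite Sab ltnn.
exists (perm S_inj) => a b; rewrite !permE /=.
case: (ltngtP (h a) (h b)) => [/S_lt -> // | /S_lt ba | /h_inj ->].
  by apply/negbTE; rewrite -leqNgt ltnW.
by rewrite ltnn.
Qed.

(** The order-reversing involution of [S], the discrete form of x -> 1 - x: [enum S] is increasing,
    so mirroring the index reverses the order. The default [x] of [nth] is never reached for [x] in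
    [S]. *)
Definition rev_in N (S : {set 'I_N}) (x : 'I_N) : 'I_N :=
  nth x (enum S) (#|S| - (index x (enum S)).+1).

Lemma sorted_enum_ord N (S : {set 'I_N}) :
  sorted (fun x y : 'I_N => x < y) (enum S).
Proof.
rewrite /enum_mem -enumT; apply: sorted_filter; first by move=> y x z; apply: ltn_trans.
by have := iota_ltn_sorted 0 N; rewrite -val_enum_ord sorted_map.
Qed.

Lemma ltn_index_enum N (S : {set 'I_N}) : {in S &, forall x y,
  (index x (enum S) < index y (enum S)) = (x < y)}.
Proof.
have lt_index : {in S &, forall x y,
    index x (enum S) < index y (enum S) -> x < y}.
  have tr : transitive (fun x y : 'I_N => x < y) by move=> b a c; apply: ltn_trans.
  move=> x y xS yS.
  by apply: (sorted_ltn_index tr (sorted_enum_ord S)); rewrite mem_enum.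
move=> x y xS yS; apply/idP/idP; first exact: lt_index.
case: (ltngtP (index x _)) => // [/lt_index ltyx | eqi] ltxy.
  by have := ltyx yS xS; lia.
have: x = y by apply: (index_inj x (s := enum S)); rewrite ?mem_enum.
by move=> xy; rewrite xy ltnn in ltxy.
Qed.

Section RevIn.
Variables (N : nat) (S : {set 'I_N}).


Lemma index_rev_in x : x \in S ->
  index (rev_in S x) (enum S) = #|S| - (index x (enum S)).+1.
Proof.
move=> xS; have S0 : 0 < #|S| by apply/card_gt0P; exists x.
by rewrite index_uniq ?enum_uniq // -cardE ltn_subrL.
Qed.

Lemma rev_in_mem x : x \in S -> rev_in S x \in S.
Proof.
move=> xS; have S0 : 0 < #|S| by apply/card_gt0P; exists x.
by rewrite -mem_enum mem_nth // -cardE ltn_subrL.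
Qed.

Lemma rev_in_lt : {in S &, forall x y, (rev_in S x < rev_in S y) = (y < x)}.
Proof.
move=> x y xS yS; rewrite -(ltn_index_enum (rev_in_mem xS) (rev_in_mem yS)).
rewrite -(ltn_index_enum yS xS) !index_rev_in //.
have : index x (enum S) < #|S| by rewrite cardE index_mem mem_enum.
have : index y (enum S) < #|S| by rewrite cardE index_mem mem_enum.
lia.
Qed.

Lemma rev_inK : {in S, involutive (rev_in S)}.
Proof.
move=> x xS; apply: (index_inj x (s := enum S)); rewrite ?mem_enum ?rev_in_mem //.
rewrite !index_rev_in ?rev_in_mem //.
have : index x (enum S) < #|S| by rewrite cardE index_mem mem_enum.
lia.
Qed.

End RevIn.

Section ReverseOnPositions.
Variables (N : nat) (W : {set 'I_N}).

Definition rev_on_fun (t : {perm 'I_N}) (x : 'I_N) : 'I_N :=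
  if x \in W then rev_in (t @: W) (t x) else t x.

Lemma rev_on_fun_inj t : injective (rev_on_fun t).
Proof.
have out x y : x \in W -> y \notin W -> rev_in (t @: W) (t x) <> t y.
  move=> xW yW txy; have := rev_in_mem (imset_f t xW).
  by rewrite txy mem_imset ?(negbTE yW) //; apply: perm_inj.
move=> x y; rewrite /rev_on_fun.
case: ifP => xW; case: ifP => yW.
- by move/(can_in_inj (@rev_inK _ _)) => /(_ (imset_f t xW) (imset_f t yW)) /perm_inj.
- by move=> E; case: (out x y xW _ E); rewrite yW.
- by move/esym=> E; case: (out y x yW _ E); rewrite xW.
- exact: perm_inj.
Qed.

Definition rev_on t : {perm 'I_N} := perm (@rev_on_fun_inj t).

Lemma rev_on_out t x : x \notin W -> rev_on t x = t x.
Proof. by rewrite permE /rev_on_fun => /negbTE ->. Qed.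

Lemma rev_on_lt t : {in W &, forall x y, (rev_on t x < rev_on t y) = (t y < t x)}.
Proof.
by move=> x y xW yW; rewrite !permE /rev_on_fun xW yW rev_in_lt ?imset_f.
Qed.

Lemma rev_on_imset t : rev_on t @: W = t @: W.
Proof.
apply/eqP; rewrite eqEcard !card_imset ?leqnn ?andbT; try exact: perm_inj.
apply/subsetP=> _ /imsetP[x xW ->]; rewrite permE /rev_on_fun xW.
by rewrite rev_in_mem ?imset_f.
Qed.

(** The labels on [W] are only permuted among themselves, so the second application reverses the
    same label set. *)
Lemma rev_onK : involutive rev_on.
Proof.
move=> t; apply/permP=> x; rewrite permE /rev_on_fun rev_on_imset.
case: ifP => xW; last by rewrite rev_on_out ?xW.
by rewrite permE /rev_on_fun xW rev_inK ?imset_f.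
Qed.

End ReverseOnPositions.

(** * Chebyshev's inequality for a transposition of positions *)

(* Exchanging the positions x and x' preserves the uniform measure on
   permutations, so a pointwise rearrangement inequality can be averaged. *)
Section Chebyshev.
Variables (N : nat) (x x' : 'I_N) (P Q : pred {perm 'I_N}).
Let sw (t : {perm 'I_N}) := (tperm x x' * t)%g.

Hypothesis opposite : forall t,
  (P t ==> P (sw t)) && (Q (sw t) ==> Q t) ||
  (P (sw t) ==> P t) && (Q t ==> Q (sw t)).

Let swK : involutive sw.
Proof. by move=> t; rewrite /sw mulgA tperm2 mul1g. Qed.

Let card2 (F : pred {perm 'I_N}) :
  2 * #|[set t | F t]| = \sum_t (F t + F (sw t)).
Proof.
have -> : #|[set t | F t]| = \sum_t F t.
  by rewrite -sum1dep_card big_mkcond /=; apply: eq_bigr => t _; case: (F t).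
rewrite big_split mul2n -addnn; congr (_ + _).
by rewrite (reindex_inj (inv_inj swK)).
Qed.

Lemma chebyshev_swap :
  #|[set t | P t && Q t]| <= #|[set t | P t && Q (sw t)]|.
Proof.
rewrite -(leq_pmul2l (isT : 0 < 2)) !card2; apply: leq_sum => t _.
rewrite swK; move: (opposite t).
by case: (P t) (P (sw t)) (Q t) (Q (sw t)) => [] [] [] [].
Qed.

(** At [t0] the two summands on the left are both 0, while [P (sw t0) && Q t0] contributes 1 on the
    right. *)
Lemma chebyshev_swap_lt t0 : P (sw t0) -> ~~ P t0 -> Q t0 -> ~~ Q (sw t0) ->
  #|[set t | P t && Q t]| < #|[set t | P t && Q (sw t)]|.
Proof.
move=> P1 P0 Q0 Q1; rewrite -(ltn_pmul2l (isT : 0 < 2)) !card2.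
rewrite (bigD1 t0) //= [X in _ < X](bigD1 t0) //= swK.
rewrite P1 Q0 (negbTE P0) (negbTE Q1) /= add0n ltnS.
apply: leq_sum => t _; rewrite swK; move: (opposite t).
by case: (P t) (P (sw t)) (Q t) (Q (sw t)) => [] [] [] [].
Qed.

End Chebyshev.

(** * Labellings that respect a set of edges *)

(** [D] is a set of edges, edge [i] joining [i] to [ordS i], and [c] is read like an orientation. *)
Definition fits m (D : {set 'I_m}) (c : 'I_m -> bool) (L : 'I_m -> nat) : bool :=
  [forall i in D, c i == (L i < L (ordS i))].

Definition lab m N (t : {perm 'I_N}) (f : 'I_m -> 'I_N) : 'I_m -> nat :=
  fun i => t (f i).

Lemma eq_fits m (D : {set 'I_m}) c (L L' : 'I_m -> nat) :
  L =1 L' -> fits D c L = fits D c L'.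
Proof. by move=> LL; apply: eq_forallb => i; rewrite !LL. Qed.

Lemma fits_setC m (D : {set 'I_m}) c L :
  fits (~: D) c L && fits D c L = fits setT c L.
Proof.
apply/andP/forall_inP=> [[/forall_inP fC /forall_inP fD] i _ | fT].
  by case: (boolP (i \in D)) => iD; [apply: fD | apply: fC; rewrite inE].
by split; apply/forall_inP => i _; apply: fT; rewrite inE.
Qed.

(** [f] avoids the last position after lifting. Choosing the label there extends each [s] in [n.+1]
    ways without changing any comparison, and every permutation arises once. *)
Lemma card_fits_lift m n (D : {set 'I_m}) c (f : 'I_m -> 'I_n) :
  #|[set t : {perm 'I_n.+1} | fits D c (lab t (lift ord_max \o f))]| =
  n.+1 * #|[set s : {perm 'I_n} | fits D c (lab s f)]|.
Proof.
pose F (js : 'I_n.+1 * {perm 'I_n}) := lift_perm ord_max js.1 js.2.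
have F_inj : injective F.
  move=> [j s] [j' s'] /permP E.
  have jj : j = j' by have := E ord_max; rewrite !lift_perm_id.
  rewrite -{j'}jj in E *; congr (_, _); apply/permP=> k.
  by have := E (lift ord_max k); rewrite !lift_perm_lift => /lift_inj.
have [G GF FG] : bijective F.
  by apply: inj_card_bij => //; rewrite card_prod !card_Sn card_ord factS.
have fitsF j s : fits D c (lab (F (j, s)) (lift ord_max \o f)) =
                 fits D c (lab s f).
  apply: eq_forallb => i; rewrite /F /lab /= !lift_perm_lift /= /bump; congr (_ ==> (_ == _)).
  by lia.
rewrite -[X in X * _]card_ord -cardsT -cardsX -(card_imset _ F_inj).
congr #|pred_of_set _|; apply/setP=> t; rewrite inE; apply/idP/imsetP.
  move=> ft; exists (G t); last by rewrite FG.
  by rewrite !inE /= -(fitsF (G t).1) -surjective_pairing FG.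
by case=> [[j s]]; rewrite !inE /= => fs ->; rewrite fitsF.
Qed.

(* [slope D c z b]: within D the arrows at z all enter it (b = true) or all
   leave it (b = false), so [fits D c] is monotone in the label of z. *)
Definition slope m (D : {set 'I_m}) (c : 'I_m -> bool) (z : 'I_m) (b : bool) :=
  (forall i, i \in D -> ordS i = z -> c i = b) /\ (z \in D -> c z = ~~ b).

(** Only edges at [z] are affected. If they all enter [z], raising its label preserves them; if they
    all leave it, lowering does. *)
Lemma fits_slope m (D : {set 'I_m}) c z b (L L' : 'I_m -> nat) :
  slope D c z b -> (forall i, i != z -> L i = L' i) ->
  (if b then L z < L' z else L' z < L z) -> (forall i : 'I_m, ordS i != i) ->
  fits D c L -> fits D c L'.
Proof.
move=> [sin sout] LL Lz S1 /forall_inP fL; apply/forall_inP=> i iD.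
have := fL i iD; have [iz | iz] := eqVneq i z.
  have zD : z \in D by rewrite -iz.
  rewrite iz (LL (ordS z)) // sout //; case: b Lz {sin sout} => /=; lia.
rewrite (LL i) //; have [Siz | Siz] := eqVneq (ordS i) z; last by rewrite LL.
by rewrite (sin _ iD Siz) Siz; case: b Lz {sin sout} => /=; lia.
Qed.

Definition upd (m : nat) (T : Type) (f : 'I_m -> T) (z : 'I_m) (x : T) : 'I_m -> T :=
  fun i => if i == z then x else f i.

Definition num_fits m N (D : {set 'I_m}) (c1 : 'I_m -> bool) (f1 : 'I_m -> 'I_N)
    (c2 : 'I_m -> bool) (f2 : 'I_m -> 'I_N) :=
  #|[set t : {perm 'I_N} | fits (~: D) c1 (lab t f1) && fits D c2 (lab t f2)]|.

(** * Giving a vertex independent labels on the two arcs *)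

Section SplitVertex.
Variables (m N : nat) (D : {set 'I_m}) (c1 c2 : 'I_m -> bool).
Variables (f1 f2 : 'I_m -> 'I_N) (z : 'I_m) (x' : 'I_N) (b1 b2 : bool).
Hypotheses (m_gt1 : forall i : 'I_m, ordS i != i) (f12 : f1 z = f2 z).
Hypotheses (f1z : forall i, i != z -> f1 i != f1 z)
           (f2z : forall i, i != z -> f2 i != f2 z).
Hypotheses (f1x : forall i, f1 i != x') (f2x : forall i, f2 i != x').
Hypotheses (slope1 : slope (~: D) c1 z b1) (slope2 : slope D c2 z b2).

Let sw (t : {perm 'I_N}) := (tperm (f1 z) x' * t)%g.
Let swK : involutive sw.
Proof. by move=> t; rewrite /sw mulgA tperm2 mul1g. Qed.

Let sw1 (t : {perm 'I_N}) : lab (sw t) f1 =1 lab t (upd f1 z x').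
Proof.
move=> i; rewrite /lab /sw permM /upd; have [-> | iz] := eqVneq; first by rewrite tpermL.
by rewrite tpermD // eq_sym ?f1z.
Qed.

Let sw2 (t : {perm 'I_N}) : lab (sw t) f2 =1 lab t (upd f2 z x').
Proof.
move=> i; rewrite /lab /sw permM /upd f12; have [-> | iz] := eqVneq; first by rewrite tpermL.
by rewrite tpermD // eq_sym ?f2z.
Qed.

Let P (t : {perm 'I_N}) := fits (~: D) c1 (lab t f1).
Let Q (t : {perm 'I_N}) := fits D c2 (lab t f2).

Let mono1 (t : {perm 'I_N}) : (if b1 then t (f1 z) < t x' else t x' < t (f1 z)) -> P t -> P (sw t).
Proof.
move=> lt; rewrite /P (eq_fits _ _ (sw1 t)); apply: (fits_slope slope1) => //=.
  by move=> i iz; rewrite /lab /upd (negbTE iz).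
by rewrite /lab /upd eqxx.
Qed.

Let mono2 (t : {perm 'I_N}) : (if b2 then t (f1 z) < t x' else t x' < t (f1 z)) -> Q t -> Q (sw t).
Proof.
move=> lt; rewrite /Q (eq_fits _ _ (sw2 t)); apply: (fits_slope slope2) => //=.
  by move=> i iz; rewrite /lab /upd (negbTE iz).
by rewrite /lab /upd eqxx -f12.
Qed.

Let sw_lt (t : {perm 'I_N}) : ((sw t (f1 z) = t x') * (sw t x' = t (f1 z)))%type.
Proof. by rewrite /sw !permM tpermL tpermR. Qed.

Let lt_or (t : {perm 'I_N}) : (t (f1 z) < t x') || (t x' < t (f1 z)).
Proof. by rewrite -neq_ltn; apply: contra_neq (f1x z) => /val_inj/perm_inj. Qed.

Let num_sw : num_fits D c1 f1 c2 (upd f2 z x') = #|[set t | P t && Q (sw t)]|.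
Proof. by apply: eq_card => t; rewrite !inE /Q (eq_fits _ _ (sw2 t)). Qed.

Let opp : b1 != b2 -> forall t,
  (P t ==> P (sw t)) && (Q (sw t) ==> Q t) ||
  (P (sw t) ==> P t) && (Q t ==> Q (sw t)).
Proof.
move=> b12 t; have := (mono1 (t := t), mono2 (t := t)).
have := (mono1 (t := sw t), mono2 (t := sw t)); rewrite !swK !sw_lt.
case: b1 b2 b12 (orP (lt_or t)) => [] [] //= _ [] -> [m1 m2] [m3 m4].
all: by apply/orP; (left + right); apply/andP; split; apply/implyP; auto.
Qed.

(** Here [z] is the middle of a directed 2-path. Reading its label at [x'] on the second arc amounts
    to evaluating [Q] at [sw t]. *)
Lemma split_vertex_le : b1 != b2 ->
  num_fits D c1 f1 c2 f2 <= num_fits D c1 f1 c2 (upd f2 z x').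
Proof. by move=> b12; rewrite num_sw; apply: chebyshev_swap (opp b12). Qed.

Lemma split_vertex_lt t0 : b1 != b2 ->
  fits (~: D) c1 (lab t0 (upd f1 z x')) -> ~~ fits (~: D) c1 (lab t0 f1) ->
  fits D c2 (lab t0 f2) -> ~~ fits D c2 (lab t0 (upd f2 z x')) ->
  num_fits D c1 f1 c2 f2 < num_fits D c1 f1 c2 (upd f2 z x').
Proof.
move=> b12; rewrite -(eq_fits _ _ (sw1 t0)) -(eq_fits _ _ (sw2 t0)) => P1 P0 Q0 Q1.
by rewrite num_sw; apply: (chebyshev_swap_lt (opp b12) (t0 := t0)).
Qed.

(** Now [z] is a source or a sink, so [P] and [Q] move together under [sw]; Chebyshev applies to [P]
    and [Q \o sw], which move oppositely. *)
Lemma split_vertex_ge : b1 = b2 ->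
  num_fits D c1 f1 c2 (upd f2 z x') <= num_fits D c1 f1 c2 f2.
Proof.
move=> b12; rewrite num_sw.
have -> : num_fits D c1 f1 c2 f2 = #|[set t | P t && (Q \o sw) (sw t)]|.
  by apply: eq_card => t; rewrite !inE /= swK.
apply: chebyshev_swap => t; rewrite -/(sw t) /= swK.
have := (mono1 (t := t), mono2 (t := t)).
have := (mono1 (t := sw t), mono2 (t := sw t)); rewrite !swK !sw_lt -b12.
case: b1 (orP (lt_or t)) => [] [] -> [m1 m2] [m3 m4].
all: by apply/orP; (left + right); apply/andP; split; apply/implyP; auto.
Qed.

End SplitVertex.

(** Reverse the labels on the positions [W] read by the second arc. The first arc reads none of
    them, so its comparisons survive, while all comparisons along [D] are flipped. *)
Lemma num_fits_flip m N (D : {set 'I_m}) c1 c2 (f1 f2 : 'I_m -> 'I_N) :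
  (forall i : 'I_m, ordS i != i) -> injective f2 ->
  (forall i j, i \notin D -> j \in D ->
     [/\ f1 i != f2 j, f1 i != f2 (ordS j), f1 (ordS i) != f2 j
       & f1 (ordS i) != f2 (ordS j)]) ->
  num_fits D c1 f1 c2 f2 = num_fits D c1 f1 (fun i => ~~ c2 i) f2.
Proof.
move=> S1 f2_inj disj.
pose W := [set f2 i | i in D] :|: [set f2 (ordS i) | i in D].
have inW i : i \in D -> (f2 i \in W) && (f2 (ordS i) \in W).
  move=> iD; rewrite !inE imset_f //=; apply/orP; right.
  by apply/imsetP; exists i.
have outW i : i \notin D -> (f1 i \notin W) && (f1 (ordS i) \notin W).
  move=> iD; rewrite !inE !negb_or.
  do ![apply/andP; split]; apply/imsetP=> [[j jD E]];
  by case: (disj i j iD jD); rewrite E eqxx.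
rewrite /num_fits -(card_imset _ (inv_inj (@rev_onK _ W))).
apply: eq_card => t; rewrite -{1}(rev_onK W t) mem_imset; last exact: inv_inj (@rev_onK _ W).
rewrite !inE; congr (_ && _); apply: eq_forallb => i; rewrite /lab.
  rewrite inE; case: (boolP (i \in D)) => //= /outW /andP[i1 i2].
  by rewrite !rev_on_out.
case: (boolP (i \in D)) => //= iD; have /andP[i1 i2] := inW i iD.
rewrite rev_on_lt //.
have : t (f2 i) != t (f2 (ordS i)) :> nat.
  apply: contra_neq (S1 i) => /val_inj/perm_inj/f2_inj E; exact/esym.
by case: (c2 i) ; case: ltngtP.
Qed.

Lemma ord_eqE n (i j : 'I_n) : (i == j) = (i == j :> nat).
Proof. by []. Qed.

Definition num_cyc m (c : 'I_m -> bool) :=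
  #|[set s : {perm 'I_m} | fits setT c (lab s id)]|.

Lemma val_ordS k (i : 'I_k.+2) : ordS i = (if i == k.+1 :> nat then 0 else i.+1) :> nat.
Proof.
rewrite /=; case: eqP => [-> | /eqP ik]; first by rewrite modnn.
by rewrite modn_small //; have := ltn_ord i; lia.
Qed.

Lemma ordS_neq k (i : 'I_k.+2) : ordS i != i.
Proof. by rewrite ord_eqE val_ordS; case: ifP; lia. Qed.

Lemma eq_num_fits m N (D : {set 'I_m}) c1 c1' c2 c2' (f1 f2 : 'I_m -> 'I_N) :
  {in ~: D, c1 =1 c1'} -> {in D, c2 =1 c2'} ->
  num_fits D c1 f1 c2 f2 = num_fits D c1' f1 c2' f2.
Proof.
move=> E1 E2; apply: eq_card => t; rewrite !inE.
by congr (_ && _); apply: eq_forallb_in => i iD; rewrite ?E1 ?E2.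
Qed.

Lemma num_fits_lift2 m (D : {set 'I_m}) c :
  let e := lift ord_max \o lift ord_max : 'I_m -> 'I_m.+2 in
  num_fits D c e c e = m.+2 * (m.+1 * num_cyc c).
Proof.
rewrite /= /num_cyc -(card_fits_lift setT c id) -(card_fits_lift setT c).
by apply: eq_card => t; rewrite !inE fits_setC.
Qed.

(** * Reversing the arc between two directed 2-paths *)

Section FlipArc.
Variables (k : nat) (c : 'I_k.+2 -> bool) (j : 'I_k.+2).
Hypotheses (jk : j < k.+1) (c0 : c ord_max = c ord0) (cj : c j = c (ordS j)).

(** The arc [D] runs from vertex 0 to vertex [q], the middles of the 2-paths given by [c0] and [cj];
    [v'] and [w'] are the extra positions for their second labels. *)
Let D := [set i : 'I_k.+2 | i <= j].
Let q := ordS j.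
Let e : 'I_k.+2 -> 'I_k.+4 := lift ord_max \o lift ord_max.
Let v' : 'I_k.+4 := ord_max.
Let w' : 'I_k.+4 := lift ord_max ord_max.

Let val_e i : e i = i :> nat.
Proof. by rewrite /= /bump; have := ltn_ord i; lia. Qed.
Let val_w : w' = k.+2 :> nat.
Proof. by rewrite /= /bump; lia. Qed.
Let val_q : q = j.+1 :> nat.
Proof. by rewrite val_ordS; case: ifP; lia. Qed.

Let e0v := upd e ord0 v'.
Let e0vqw := upd e0v q w'.

Let val_e0v i : e0v i = (if i == 0 :> nat then k.+3 else i) :> nat.
Proof. by rewrite /e0v /upd ord_eqE; case: ifP => // _; rewrite val_e. Qed.

Let val_e0vqw i :
  e0vqw i = (if i == j.+1 :> nat then k.+2 else if i == 0 :> nat then k.+3 else i) :> nat.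
Proof.
rewrite /e0vqw /upd ord_eqE val_q; by case: ifP => _; [exact: val_w | exact: val_e0v].
Qed.

Let ordS0 (i : 'I_k.+2) : ordS i = ord0 -> i = ord_max.
Proof.
move/(congr1 (@nat_of_ord _)); rewrite val_ordS; case: eqP => // ik _; exact: val_inj.
Qed.

Let slope1_0 : slope (~: D) c ord0 (c ord0).
Proof. by split=> [i _ /ordS0 -> // |]; rewrite !inE. Qed.

(** The bit [b] treats the arc before ([false]) and after ([true]) its reversal at once. *)
Let slope2_0 b : slope D (fun i => b (+) c i) ord0 (~~ b (+) c ord0).
Proof.
split=> [i iD /ordS0 E | _]; last by case: b (c ord0) => [] [].
by move: iD; rewrite E inE /=; lia.
Qed.

Let slope1_q : slope (~: D) c q (~~ c q).
Proof.
by split=> [i iD /ordS_inj E | _]; [move: iD; rewrite E !inE leqnn | rewrite negbK].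
Qed.

Let slope2_q b : slope D (fun i => b (+) c i) q (b (+) c q).
Proof.
split=> [i iD /ordS_inj -> | ]; first by rewrite cj.
by rewrite inE val_q ltnn.
Qed.

Let e_neq0 i : i != ord0 -> e i != e ord0.
Proof. by rewrite !ord_eqE !val_e. Qed.
Let e_neqq i : i != q -> e i != e q.
Proof. by rewrite !ord_eqE !val_e. Qed.
Let e_neqv i : e i != v'.
Proof. by rewrite ord_eqE val_e /=; have := ltn_ord i; lia. Qed.
Let e_neqw i : e i != w'.
Proof. by rewrite ord_eqE val_e val_w; have := ltn_ord i; lia. Qed.
Let e0v_q : e q = e0v q.
Proof. by apply/ord_inj; rewrite val_e val_e0v val_q. Qed.
Let e0v_neqq i : i != q -> e0v i != e0v q.
Proof.
by rewrite !ord_eqE !val_e0v val_q /=; have := ltn_ord i; case: ifP; lia.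
Qed.
Let e0v_neqw i : e0v i != w'.
Proof. by rewrite ord_eqE val_e0v val_w; have := ltn_ord i; case: ifP; lia. Qed.

Let witness : exists t : {perm 'I_k.+4},
  [/\ fits (~: D) c (lab t e0v), ~~ fits (~: D) c (lab t e),
      fits D c (lab t e) & ~~ fits D c (lab t e0v)].
Proof.
(* v and v' get extreme labels; along 1, 2, ..., k + 1 every label lies beyond all
   previous ones, above or below them as the arrow prescribes. *)
pose M := k.+4.
(* [M] exceeds every position, so the values [2 * M + a] and [2 * M - a] lie strictly between 0 and
   [4 * M]; [5 * M] at [w'] only has to differ from all others. [inord a.-1] is the edge from
   [a - 1] to [a]. *)
pose h (a : 'I_k.+4) :=
  if a == 0 :> nat then if c ord0 then 0 else 4 * M else
  if a == k.+3 :> nat then if c ord0 then 4 * M else 0 else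
  if a == k.+2 :> nat then 5 * M else
  if c (inord a.-1) then 2 * M + a else 2 * M - a.
have h_inj : injective h.
  move=> a a'; rewrite /h => E; apply/ord_inj; move: E.
  have := ltn_ord a; have := ltn_ord a'; rewrite /M.
  by case: (c ord0); do ![case: ifP]; lia.
have [t ht] := perm_of_injective_ranks h_inj.
have hS (i : 'I_k.+2) : ordS i != ord0 -> h (e (ordS i)) = 
    if c i then 2 * M + i.+1 else 2 * M - i.+1.
  move=> Si0; have ik : (i == k.+1 :> nat) = false.
    by apply: contraNF Si0 => ik; rewrite ord_eqE val_ordS ik.
  rewrite /h !val_e val_ordS ik /=; have := ltn_ord i.
  case: eqP => [|_ _]; first lia.
  case: eqP => [|_]; first by move/eqP: ik; lia.
  by rewrite inord_val.
have he (i : 'I_k.+2) : i != ord0 -> exists d : bool, h (e i) = if d then 2 * M + i else 2 * M - i.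
  move=> i0; exists (c (inord i.-1)); rewrite /h !val_e.
  by have := ltn_ord i; move: i0; rewrite ord_eqE /=; do ![case: eqP]; lia.
have e0vE (i : 'I_k.+2) : i != ord0 -> e0v i = e i by rewrite /e0v /upd => /negbTE ->.
(* The label at [ordS i] is farther from [2 * M] than the one at [i], so its sign, set by [c i],
   decides the comparison for either sign [d]. *)
have step (i : 'I_k.+2) : i != ord0 -> ordS i != ord0 -> c i == (t (e i) < t (e (ordS i))).
  move=> i0 Si0; rewrite ht hS //; have [d ->] := he i i0.
  by case: (c i) d => [] []; have := ltn_ord i; rewrite /M; lia.
have S0 : ordS ord_max = ord0 :> 'I_k.+2.
  by apply: ord_inj; rewrite val_ordS eqxx.
have max0 : ord_max != ord0 :> 'I_k.+2 by [].
have S1 : ordS ord0 != ord0 :> 'I_k.+2 by exact: ordS_neq.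
have h0 : h (e ord0) = if c ord0 then 0 else 4 * M by rewrite /h val_e.
have hv : h v' = if c ord0 then 4 * M else 0 by rewrite /h /= eqxx.
have e0v0 : e0v ord0 = v' by rewrite /e0v /upd eqxx.
have [d hmax] := he ord_max max0.
have h1 := hS ord0 S1.
exists t; split.
- apply/forall_inP => i; rewrite !inE -ltnNge => ij.
  have i0 : i != ord0 by rewrite ord_eqE /=; lia.
  rewrite /lab e0vE //; have [Si0 | Si0] := eqVneq (ordS i) ord0; last by rewrite e0vE ?step.
  rewrite Si0 (ordS0 Si0) c0 ht e0v0 hv hmax.
  by case: (c ord0) d {hmax} => [] []; rewrite /M /=; lia.
- apply/forall_inP => /(_ ord_max); rewrite !inE -ltnNge /= jk => /(_ isT).
  rewrite /lab S0 c0 ht h0 hmax.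
  by case: (c ord0) d {hmax} => [] []; rewrite /M /=; lia.
- apply/forall_inP => i; rewrite inE => ij.
  have Si0 : ordS i != ord0.
    by apply: contraTneq ij => /ordS0 ->; rewrite -ltnNge.
  have [-> | i0] := eqVneq i ord0; last exact: step.
  by rewrite /lab ht h0 h1; case: (c ord0); rewrite /M; lia.
- apply/forall_inP => /(_ ord0); rewrite inE /= => /(_ isT).
  by rewrite /lab e0v0 e0vE // ht hv h1; case: (c ord0); rewrite /M /=; lia.
Qed.

(** Cut at 0, cut at [q], reverse, glue at [q], glue at 0; strictness comes from the first cut,
    through [witness]. *)
Lemma flip_arc_lt :
  num_cyc c < num_cyc (fun i => if i <= j then ~~ c i else c i).
Proof.
have cut_lt : num_fits D c e c e < num_fits D c e c e0v.
  have [t [t1 t2 t3 t4]] := witness.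
  apply: (split_vertex_lt (t0 := t) _ _ _ _ _ _ slope1_0 (slope2_0 false)) => //.
  - exact: ordS_neq.
  - by case: (c ord0).
have cut_le : num_fits D c e c e0v <= num_fits D c e c e0vqw.
  apply: (split_vertex_le _ _ _ _ _ _ slope1_q (slope2_q false)) => //.
  - exact: ordS_neq.
  - by case: (c q).
have reverse : num_fits D c e c e0vqw = num_fits D c e (fun i => ~~ c i) e0vqw.
  apply: num_fits_flip; first exact: ordS_neq.
    move=> a b /(congr1 (@nat_of_ord _)); rewrite !val_e0vqw => E; apply: ord_inj.
    by have := ltn_ord a; have := ltn_ord b; move: E; do ![case: ifP]; lia.
  move=> a b; rewrite !inE -ltnNge => ja bj.
  have bk : (b == k.+1 :> nat) = false by lia.
  rewrite !ord_eqE !val_e !val_e0vqw !val_ordS bk.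
  have := ltn_ord a; have := ltn_ord b.
  by split; do ![case: ifP => ?]; lia.
have glue_le : num_fits D c e (fun i => ~~ c i) e0vqw <= num_fits D c e (fun i => ~~ c i) e0v.
  by apply: (split_vertex_ge _ _ _ _ _ _ slope1_q (slope2_q true)) => //; exact: ordS_neq.
have glue_le' : num_fits D c e (fun i => ~~ c i) e0v <= num_fits D c e (fun i => ~~ c i) e.
  by apply: (split_vertex_ge _ _ _ _ _ _ slope1_0 (slope2_0 true)) => //; exact: ordS_neq.
(* Both counts acquire the same factor from the two extra positions. *)
rewrite -(ltn_pmul2l (isT : 0 < k.+3)) -(ltn_pmul2l (isT : 0 < k.+4)).
rewrite -!(num_fits_lift2 D) -/e.
rewrite [X in _ < X](eq_num_fits (c1' := c) (c2' := fun i => ~~ c i)); first last.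
- by move=> i; rewrite inE => ->.
- by move=> i; rewrite !inE => /negbTE ->.
apply: leq_trans cut_lt _; apply: leq_trans cut_le _.
by rewrite reverse (leq_trans glue_le).
Qed.

End FlipArc.

(** * Linear extensions and directed 2-paths, edge by edge *)

Lemma dlt_lt m (o : cycle_orientation m) (L : 'I_m -> nat) :
  (forall u v, Defs.arc o u v -> L u < L v) -> forall u v, dlt o u v -> L u < L v.
Proof.
move=> arcL u v /existsP[w /andP[/arcL uw /connectP[p]]].
elim: p w uw => [w uw _ -> // | a p IHp w uw /= /andP[/arcL wa ap] vE].
exact: (IHp a (ltn_trans uw wa)).
Qed.

Lemma mem_linext k (o : cycle_orientation k.+2) s :
  (s \in linear_extensions o) = fits setT o (lab s id).
Proof.
have s_neq i : s i != s (ordS i) :> nat.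
  by apply: contra_neq (ordS_neq i) => /val_inj/perm_inj.
have arc_dlt u v : Defs.arc o u v -> dlt o u v.
  by move=> uv; apply/existsP; exists v; rewrite uv connect0.
rewrite inE; apply/forallP/forall_inP => [H i _ | H u].
  have arcs u v : Defs.arc o u v -> s u < s v.
    by move=> /arc_dlt uv; move/forallP/(_ v)/implyP: (H u); apply.
  have [oi | oi] := boolP (o i); rewrite /lab eq_sym; last rewrite eqbF_neg -leqNgt.
    by rewrite arcs // /Defs.arc oi eqxx.
  by rewrite ltnW // arcs // /Defs.arc oi eqxx orbT.
apply/forallP=> v; apply/implyP; apply: (dlt_lt (L := lab s id)) => {u}{}v w.
case/orP => /andP[].
  by move=> ov /eqP ->; have := H v; rewrite inE ov => /(_ isT) /eqP <-.
move=> ow /eqP ->; have := H w; rewrite inE (negbTE ow) => /(_ isT).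
by have := s_neq w; rewrite /lab /=; case: ltngtP.
Qed.

Lemma num_linextE k (o : cycle_orientation k.+2) : num_linext o = num_cyc o.
Proof. by apply: eq_card => s; rewrite mem_linext inE. Qed.

(** This yields acyclicity of an improved orientation from its positive count alone. *)
Lemma acyclic_num_linext m (o : cycle_orientation m) : 0 < num_linext o -> acyclic o.
Proof.
case/card_gt0P=> s; rewrite inE => /forallP s_ext; apply/forallP=> u.
by apply/negP=> uu; move/forallP/(_ u): (s_ext u); rewrite uu ltnn.
Qed.

Definition repeats m (c : 'I_m -> bool) := [set i | c i == c (ordS i)].

Lemma num_dir_2pathsE m (o : cycle_orientation m) : num_dir_2paths o = #|repeats o|.
Proof.
(* Each repeat gives the 2-path with middle [ordS i], traversed in the direction of its edges. *)
pose F i := if o i then (i, ordS i, ordS (ordS i)) else (ordS (ordS i), ordS i, i).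
have F_inj : injective F.
  move=> i j /(congr1 (fun t => t.1.2)); rewrite /F.
  by case: ifP => _; case: ifP => _ /ordS_inj.
rewrite -(card_imset _ F_inj); apply: eq_card => -[[u v] w]; rewrite inE /=.
apply/andP/imsetP => [[/orP[] /andP[o1 /eqP E1] /orP[] /andP[o2 /eqP E2]] | [i]].
- by exists u; rewrite ?inE /F ?o1 -?E1 ?o2 -?E2.
- by move: o2; rewrite -(ordS_inj (etrans (esym E1) E2)) o1.
- by rewrite o2 in o1.
- by exists w; rewrite ?inE /F -?E2 ?(negbTE o1) ?(negbTE o2) -?E1.
rewrite inE /F /Defs.arc => /eqP; case: ifP => oi /esym oSi [-> -> ->].
  by rewrite oi oSi !eqxx.
by rewrite oi oSi !eqxx !orbT.
Qed.

(** The complement consists of the changes of direction, and going once around the cycle their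
    number is even: modulo 2 each [c i] is counted twice. *)
Lemma odd_repeats m (c : 'I_m -> bool) : odd #|repeats c| = odd m.
Proof.
have card_odd (A : {set 'I_m}) : odd #|A| = \big[addb/false]_i (i \in A).
  rewrite -sum1_card big_mkcond /= (big_morph odd oddD (erefl (odd 0))).
  by apply: eq_bigr => i _; case: ifP.
have : odd #|~: repeats c| = false.
  rewrite card_odd (eq_bigr (fun i => c i (+) c (ordS i))).
    rewrite big_split /= [X in _ (+) X](_ : _ = \big[addb/false]_i c i) ?addbb //.
    by rewrite [RHS](reindex_inj (@ordS_inj m)).
  by move=> i _; rewrite !inE; case: (c i) (c (ordS i)) => [] [].
have := cardsC (repeats c); rewrite card_ord => /(congr1 odd); rewrite oddD.
by move=> <- ->; rewrite addbF.
Qed.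

(** * Rotations and global reversal of the cycle *)

Definition rot_by m j (c : 'I_m -> bool) : 'I_m -> bool := fun i => c (iter j (@ordS m) i).

Lemma eq_num_cyc m (c c' : 'I_m -> bool) : c =1 c' -> num_cyc c = num_cyc c'.
Proof. by move=> cc; apply: eq_card => s; rewrite !inE; apply: eq_forallb => i; rewrite cc. Qed.

Lemma num_cyc_rot m j (c : 'I_m -> bool) : num_cyc (rot_by j c) = num_cyc c.
Proof.
elim: j => // j <-; pose r := perm (@ordS_inj m).
rewrite /num_cyc -[RHS](card_imset _ (mulgI r)); apply: eq_card => s.
rewrite -(mulKVg r s) mem_imset; last exact: mulgI.
set s' := (r^-1 * s)%g.
rewrite !inE; apply/forall_inP/forall_inP => H i _; last first.
  by have := H (ordS i) (in_setT _); rewrite /lab /rot_by !permM !permE iterSr.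
have := H (ord_pred i) (in_setT _).
by rewrite /lab /rot_by !permM !permE iterSr ord_predK.
Qed.

Lemma mem_repeats_rot m j (c : 'I_m -> bool) i :
  (i \in repeats (rot_by j c)) = (iter j (@ordS m) i \in repeats c).
Proof. by rewrite !inE /rot_by -iterS -iterSr. Qed.

Lemma card_repeats_rot m j (c : 'I_m -> bool) : #|repeats (rot_by j c)| = #|repeats c|.
Proof.
have it_inj : injective (iter j (@ordS m)).
  by elim: j => // j IHj a b /ordS_inj /IHj.
rewrite -(card_preimset (repeats c) it_inj); apply: eq_card => i.
by rewrite mem_repeats_rot [RHS]inE.
Qed.

Lemma iter_ordS_transitive m (x y : 'I_m) : exists j, iter j (@ordS m) x = y.
Proof.
have val_iter j : iter j (@ordS m) x = (x + j) %% m :> nat.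
  elim: j => [|j IHj]; first by rewrite addn0 modn_small.
  by rewrite iterS /= IHj -addn1 modnDml addn1 addnS.
(* This is y - x modulo [m], avoiding truncated subtraction. *)
exists (y + (m - x)); apply: ord_inj; rewrite val_iter addnCA subnKC; last exact: ltnW.
by rewrite modnDr modn_small.
Qed.

Lemma num_cyc_negb k (c : 'I_k.+2 -> bool) : num_cyc (fun i => ~~ c i) = num_cyc c.
Proof.
pose r : {perm 'I_k.+2} := perm (@rev_ord_inj k.+2).
pose g (s : {perm 'I_k.+2}) := (s * r)%g.
have gK : involutive g.
  by move=> s; apply/permP=> i; rewrite !permM !permE rev_ordK.
rewrite /num_cyc -[LHS](card_imset _ (inv_inj gK)); apply: eq_card => s.
rewrite -{1}(gK s) mem_imset; last exact: inv_inj gK.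
rewrite !inE; apply: eq_forallb => i; rewrite /lab !permM !permE /=.
have : s i != s (ordS i) :> nat.
  by apply: contra_neq (ordS_neq i) => /val_inj/perm_inj.
have := ltn_ord (s i); have := ltn_ord (s (ordS i)).
by case: (c i); lia.
Qed.

(** Rotate until the single repeats coincide. Then both patterns change direction at the same
    places, so [c i (+) c' i] is constant and they agree up to global reversal. *)
Lemma num_cyc_one_repeat k (c c' : 'I_k.+2 -> bool) :
  #|repeats c| = 1 -> #|repeats c'| = 1 -> num_cyc c = num_cyc c'.
Proof.
move=> /eqP/cards1P[x xE] Rc'; have /cards1P[y yE] := introT eqP Rc'.
have [j jE] := iter_ordS_transitive x y.
rewrite -(num_cyc_rot j c'); move: (rot_by j c') (mem_repeats_rot j c' x) (card_repeats_rot j c').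
rewrite jE Rc' yE set11 {c' Rc' yE j jE} => c' xR /eqP/cards1P[x' x'E].
move: xR; rewrite x'E inE => /eqP xx; rewrite -{x'}xx in x'E.
have same i : c i (+) c' i = c (ordS i) (+) c' (ordS i).
  have /setP/(_ i) := etrans xE (esym x'E); rewrite !inE.
  by case: (c i) (c' i) (c (ordS i)) (c' (ordS i)) => [] [] [] [].
have const i : c i (+) c' i = c ord0 (+) c' ord0.
  have [l <-] := iter_ordS_transitive ord0 i.
  by elim: l => // l IHl; rewrite iterS -same.
case: (boolP (c ord0 (+) c' ord0)) => [d|d].
  rewrite -num_cyc_negb; apply: eq_num_cyc => i.
  by have := const i; rewrite d; case: (c i) (c' i) => [] [].
apply: eq_num_cyc => i.
by have := const i; rewrite (negbTE d); case: (c i) (c' i) => [] [].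
Qed.

(** * Descent to a single directed 2-path *)

(** Rotate one repeat to [ord_max], so that its middle is vertex 0, and flip the edges up to another
    repeat [j]: exactly these two repeats disappear. *)
Lemma num_cyc_improve k (c : 'I_k.+2 -> bool) : 1 < #|repeats c| ->
  exists c' : 'I_k.+2 -> bool, #|repeats c'| < #|repeats c| /\ num_cyc c < num_cyc c'.
Proof.
case/card_gt1P=> x [y [xR yR xy]].
have [l lE] := iter_ordS_transitive ord_max x.
have /subsetPn[j] : ~~ (repeats (rot_by l c) \subset [set ord_max]).
  apply/negP=> /subset_leq_card; rewrite cards1 card_repeats_rot leqNgt.
  by case/negP; apply/card_gt1P; exists x, y.
rewrite -(num_cyc_rot l c) -(card_repeats_rot l c).
have : ord_max \in repeats (rot_by l c) by rewrite mem_repeats_rot lE.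
move: (rot_by l c) => {x y xR yR xy l lE} {}c mR jR; rewrite inE => jmax.
have S0 : ordS ord_max = ord0 :> 'I_k.+2 by apply: ord_inj; rewrite val_ordS eqxx.
have jk : j < k.+1 by move: jmax; rewrite ord_eqE /=; have := ltn_ord j; lia.
move: (mR) (jR); rewrite !inE S0 => /eqP c0 /eqP cj.
exists (fun i : 'I_k.+2 => if i <= j then ~~ c i else c i); split; last exact: flip_arc_lt.
apply/proper_card/properP; split; last first.
  exists j => //; rewrite inE leqnn val_ordS -cj (ltn_eqF jk) ltnn.
  by case: (c j).
apply/subsetP=> i; rewrite !inE.
have [iM | iM] := eqVneq i ord_max.
  by rewrite iM S0 /= c0 (leqNgt k.+1) jk /=; case: (c ord0).
have [-> | ij] := eqVneq i j; first by rewrite cj.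
(* Away from the two cut vertices, consecutive edges are flipped together or not at all. *)
have -> : (ordS i <= j) = (i <= j).
  rewrite val_ordS; move: iM ij; rewrite !ord_eqE /= => /negbTE ->.
  lia.
by case: ifP => // _; case: (c i) (c (ordS i)) => [] [].
Qed.

(** Induction on the number of repeats: it is odd, so improvement can only stop at one repeat, where
    all counts agree. *)
Lemma num_cyc_one_repeat_max k (c c' : 'I_k.+2 -> bool) : odd k ->
  #|repeats c| = 1 -> num_cyc c' <= num_cyc c.
Proof.
move=> k_odd c1; move: {2}#|repeats c'|.+1 (ltnSn #|repeats c'|) => N.
elim: N c' => // N IHN c' ltN; have := odd_repeats c'; rewrite /= negbK k_odd.
case E: #|repeats c'| => [|[|r]] // _; first by rewrite (num_cyc_one_repeat E c1).
have [|d [dr dlt]] := @num_cyc_improve _ c'; first by rewrite E.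
by apply: leq_trans (ltnW dlt) _; apply: IHN; apply: leq_trans dr _.
Qed.

Theorem theorem2p8 (n : nat) (hn : 1 <= n) (o : cycle_orientation n.*2.+1) :
  (acyclic o /\
   (forall o' : cycle_orientation n.*2.+1, acyclic o' -> num_linext o' <= num_linext o))
  <-> almost_bipartite o.
Proof.
(* The cycle length becomes [k.+2] with [k = n.*2.+1] odd. *)
case: n hn o => // n _; rewrite doubleS => o.
rewrite /almost_bipartite num_dir_2pathsE; split=> [[o_acyc o_max] | [o_acyc o1]].
  split=> //; have := odd_repeats o; rewrite /= negbK odd_double.
  case E: #|repeats o| => [|[|r]] // _.
  have [|o' [_ lt]] := @num_cyc_improve _ o; first by rewrite E.
  rewrite -!num_linextE in lt.
  have := o_max o' (acyclic_num_linext (leq_ltn_trans (leq0n _) lt)).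
  by rewrite leqNgt lt.
split=> // o' _; rewrite !num_linextE; apply: num_cyc_one_repeat_max => //.
by rewrite /= odd_double.
Qed.
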